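(* Let $Q$ be a quadruple system of order $v$. If there is a Kirkman triple system $K(Q)$ built from $Q$ which is $\delta$-colourable, then $Q$ has a $\delta$-colouring.
   Context: A quadruple system of order $v$ is a set of $v$ points with a set of $4$-subsets (blocks) such that each pair of points lies in exactly one block. Given a quadruple system $Q$ on points $\{q_0,\dots,q_{v-1}\}$, a $K(Q)$ is a Kirkman triple system (Steiner triple system with a partition of its triples into parallel classes) on the point set $\{\infty\}\cup\{q_i,q_i' : 0\le i\le v-1\}$ obtained as follows: for each block $\{w,x,y,z\}$ of $Q$, place the triples of a KTS$(9)$ on $\{\infty,w,x,y,z,w',x',y',z'\}$ in such a way that the triples containing $\infty$ are $\{\infty,w,w'\},\{\infty,x,x'\},\{\infty,y,y'\},\{\infty,z,z'\}$; the placement is not unique, so several $K(Q)$ may arise. A $\delta$-colouring of a design is a map from its points to a set of $\delta$ colours such that no block is monochromatic; the design is $\delta$-colourable if it has one. *)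

(* Defs.v *)
From mathcomp Require Import all_boot.

Set Implicit Arguments.
Unset Strict Implicit.
Unset Printing Implicit Defensive.

Section Designs.
Variable P : finType.
Implicit Types (X : {set P}) (D : {set {set P}}) (R : {set {set {set P}}}).

(* A 2-(n, k, 1) design with point set X and block set D. *)
Definition pair_design (k n : nat) X D : Prop :=
  [/\ #|X| = n,
      (forall B, B \in D -> B \subset X /\ #|B| = k)
    & (forall x y, x \in X -> y \in X -> x != y ->
         exists! B, [/\ B \in D, x \in B & y \in B])].

Definition steiner_triple_system (n : nat) X D : Prop := pair_design 3 n X D.

(* R is the set of parallel classes. *)
Definition kirkman_triple_system (n : nat) X D R : Prop :=
  [/\ steiner_triple_system n X D,
      partition R D
    & (forall C, C \in R -> partition C X)].

Definition monochromatic (K : Type) (c : P -> K) (B : {set P}) : Prop :=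
  exists k, forall x, x \in B -> c x = k.

Definition colouring (delta : nat) D (c : P -> 'I_delta) : Prop :=
  forall B, B \in D -> ~ monochromatic c B.

Definition colourable (delta : nat) D : Prop :=
  exists c : P -> 'I_delta, colouring D c.

End Designs.

Definition quadruple_system (V : finType) (v : nat) (Q : {set {set V}}) : Prop :=
  pair_design 4 v [set: V] Q.

(* The point set {oo} U {q, q' : q in V}. *)
Definition kpoint (V : finType) : finType := option (V * bool).

Section KirkmanFromQuadruple.
Variable V : finType.

Definition infty : kpoint V := None.
Definition unprimed (q : V) : kpoint V := Some (q, false).
Definition primed (q : V) : kpoint V := Some (q, true).

Definition block_points (B : {set V}) : {set kpoint V} :=
  infty |: ([set unprimed q | q in B] :|: [set primed q | q in B]).

Definition infty_triple (q : V) : {set kpoint V} :=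
  [set infty; unprimed q; primed q].

(* (D, R) is one of the systems K(Q); t B and r B are the triples and parallel
   classes of the KTS(9) placed on the block B. *)
Definition is_KQ (Q : {set {set V}})
    (D : {set {set kpoint V}}) (R : {set {set {set kpoint V}}}) : Prop :=
  kirkman_triple_system (2 * #|V| + 1) [set: kpoint V] D R /\
  exists (t : {set V} -> {set {set kpoint V}})
         (r : {set V} -> {set {set {set kpoint V}}}),
    (forall B, B \in Q ->
       kirkman_triple_system 9 (block_points B) (t B) (r B) /\
       [set b in t B | infty \in b] = [set infty_triple q | q in B]) /\
    D = \bigcup_(B in Q) t B.

End KirkmanFromQuadruple.

(* Main.v *)
Require Import Defs.
From mathcomp Require Import all_boot.

(** Restricting a colouring of K(Q) to the unprimed points colours Q.  The reason
    is that in a KTS(9) placed on a block {a, b, c, d} some triple consists of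
    unprimed points only.  Otherwise the third point on the line through two
    unprimed points x, y is primed, and it is neither x' nor y', since the lines
    x x' and y y' pass through oo.  Say the line a b contains c'.  As a c' and
    b c' are used up, a d contains b' and b d contains a'; hence both a c and
    b c contain d', so that c d' lies on two lines. *)

Section Designs.
Variable P : finType.
Implicit Types (X T : {set P}) (D : {set {set P}}).

Lemma pair_design_uniq k n X D T1 T2 x y :
  pair_design k n X D -> T1 \in D -> T2 \in D -> x != y ->
  x \in T1 -> y \in T1 -> x \in T2 -> y \in T2 -> T1 = T2.
Proof.
move=> [_ sDX uD] T1D T2D xy x1 y1 x2 y2.
have [/subsetP sT1 _] := sDX _ T1D.
have [T [_ uT]] := uD x y (sT1 _ x1) (sT1 _ y1) xy.
by rewrite -(uT T1) // -(uT T2).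
Qed.

Lemma card3_eq T x y z :
  #|T| = 3 -> x \in T -> y \in T -> z \in T -> uniq [:: x; y; z] ->
  T = [set x; y; z].
Proof.
move=> T3 xT yT zT xyz; apply/esym/eqP; rewrite eqEcard T3; apply/andP; split.
  by apply/subsetP=> u; rewrite !inE => /orP[/orP[]|] /eqP->.
have -> : #|[set x; y; z]| = size [:: x; y; z] by
  rewrite -(card_uniqP xyz); apply: eq_card => u; rewrite !inE orbA.
by [].
Qed.

Lemma steiner_third_point n X D x y :
  steiner_triple_system n X D -> x \in X -> y \in X -> x != y ->
  exists T z, [/\ T \in D, T = [set x; y; z], z \in X, z != x & z != y].
Proof.
move=> [_ sDX uD] xX yX xy; have [T [[TD xT yT] _]] := uD x y xX yX xy.
have [/subsetP sTX T3] := sDX T TD.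
have /card_gt0P[z] : 0 < #|T :\ x :\ y|.
  by move: T3; rewrite (cardsD1 x) xT (cardsD1 y) !inE (eq_sym y) xy yT !add1n => -[->].
rewrite !inE => /and3P[zy zx zT]; exists T, z; split=> //; last exact: sTX.
by apply: card3_eq => //=; rewrite !inE negb_or xy !(eq_sym _ z) zx zy.
Qed.

End Designs.

Section UnprimedTriple.
Variables (V : finType) (B : {set V}) (D : {set {set kpoint V}}).
Hypothesis stsD : steiner_triple_system 9 (block_points B) D.
Hypothesis inftyD :
  [set T in D | infty V \in T] = [set infty_triple q | q in B].
Local Notation u := (@unprimed V).
Local Notation p := (@primed V).

Lemma unprimed_in_triple a q : (u a \in infty_triple q) = (a == q).
Proof.
rewrite !inE; apply/idP/eqP => [|->]; last by rewrite eqxx orbT.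
by case/orP=> [/orP[]|] /eqP[].
Qed.

Lemma infty_triple_in_design q : q \in B -> infty_triple q \in D.
Proof.
move=> qB; have: infty_triple q \in [set T in D | infty V \in T].
  by rewrite inftyD; apply: imset_f.
by rewrite inE => /andP[].
Qed.

(** The triple [infty_triple q] lies in [D] and already joins [u q] to [p q], and two points lie on
    only one triple. *)
Lemma line_through_infty q T :
  q \in B -> T \in D -> u q \in T -> p q \in T -> T = infty_triple q.
Proof.
move=> qB TD uT pT.
apply: (pair_design_uniq _ _ _ _ _ _ _ (u q) (p q) stsD) => //.
- exact: infty_triple_in_design.
- exact/eqP.
- by rewrite unprimed_in_triple.
- by rewrite !inE eqxx orbT.
Qed.

(** The third point on the line is not [infty], since a triple through [infty] has a single unprimed
    point. For the same reason it is neither [p a] nor [p b]: by [line_through_infty] either one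
    would make the line a triple through [infty]. *)
Lemma unprimed_line a b : a \in B -> b \in B -> a != b ->
  (exists q, [/\ q \in B, q != a, q != b & [set u a; u b; u q] \in D]) \/
  (exists q T, [/\ q \in B, q != a, q != b &
                   [/\ T \in D, u a \in T, u b \in T & p q \in T]]).
Proof.
move=> aB bB ab.
have uX q : q \in B -> u q \in block_points B.
  by move=> qB; rewrite !inE imset_f ?orbT.
have uI : injective u by move=> x y [].
have [|T [z [TD defT zX za zb]]] :=
  steiner_third_point _ _ _ _ _ _ stsD (uX a aB) (uX b bB).
  by rewrite inj_eq.
have [aT bT zT] : [/\ u a \in T, u b \in T & z \in T].
  by rewrite defT !inE !eqxx ?orbT.
move: zX; rewrite in_setU1 in_setU => /or3P[/eqP zE|/imsetP[q qB zE]|/imsetP[q qB zE]].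
- have: T \in [set T in D | infty V \in T] by rewrite inE TD -zE.
  rewrite inftyD => /imsetP[q _ TE]; move: ab aT bT.
  by rewrite TE !unprimed_in_triple => + /eqP aq /eqP bq; rewrite aq bq eqxx.
- by left; exists q; rewrite -(inj_eq uI) -(inj_eq uI q) -zE -defT.
- right; exists q, T; rewrite -zE; split=> //; apply/eqP=> qE; subst q.
    move: bT; rewrite (line_through_infty a T aB TD aT) -?zE // unprimed_in_triple.
    by rewrite eq_sym (negbTE ab).
  move: aT; rewrite (line_through_infty b T bB TD bT) -?zE // unprimed_in_triple.
  by rewrite (negbTE ab).
Qed.

Lemma unprimed_triple : #|B| = 4 ->
  exists2 T, T \in D & T \subset [set u q | q in B].
Proof.
move=> B4.
(* From here on the argument is by contradiction, assuming that every triple leaves the unprimed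
   points. *)
case: (boolP [exists T in D, T \subset [set u q | q in B]]) => [/exists_inP //|].
rewrite negb_exists_in => /forall_inP noT.
have no3 x y z T : x \in B -> y \in B -> z \in B -> uniq [:: x; y; z] ->
    T \in D -> u x \in T -> u y \in T -> u z \in T -> False.
  move=> xB yB zB xyz TD xT yT zT; have [_ sD _] := stsD.
  have TE : T = [set u x; u y; u z].
    apply: card3_eq => //; first by have [] := sD T TD.
    by rewrite -[[:: _; _; _]]/(map u [:: x; y; z]) map_inj_uniq // => ? ? [].
  move/negP: (noT T TD); apply; rewrite TE; apply/subsetP=> w.
  by rewrite !inE => /orP[/orP[]|] /eqP->; apply: imset_f.
have line x y : x \in B -> y \in B -> x != y -> exists q T,
    [/\ q \in B, q != x, q != y & [/\ T \in D, u x \in T, u y \in T & p q \in T]].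
  move=> xB yB xy; have [[q [qB _ _ TD]]|//] := unprimed_line x y xB yB xy.
  move/negP: (noT _ TD); case; apply/subsetP=> w.
  by rewrite !inE => /orP[/orP[]|] /eqP->; apply: imset_f.
(* Sharing [u x] and [p q] forces [T1 = T2], which then holds three unprimed points. *)
have clash x y z q T1 T2 : x \in B -> y \in B -> z \in B -> uniq [:: x; y; z] ->
    T1 \in D -> u x \in T1 -> u y \in T1 -> p q \in T1 ->
    T2 \in D -> u x \in T2 -> u z \in T2 -> p q \in T2 -> False.
  move=> xB yB zB xyz T1D x1 y1 q1 T2D x2 z2 q2.
  apply: (no3 x y z T1) => //.
  by rewrite (pair_design_uniq _ _ _ _ _ T1 T2 (u x) (p q) stsD) //; apply/eqP.
have core a b c d : uniq [:: a; b; c; d] -> B =i [:: a; b; c; d] ->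
    forall T, T \in D -> u a \in T -> u b \in T -> p c \in T -> False.
  move=> abcd BE T TD aT bT cT.
  have [aB bB cB dB] : [/\ a \in B, b \in B, c \in B & d \in B].
    by rewrite !BE !inE !eqxx ?orbT.
  move: abcd; rewrite /= !inE !negb_or !andbT.
  move=> /and3P[/and3P[ab ac ad] /andP[bc bd] cd].
  have [ba ca da] : [/\ b != a, c != a & d != a] by rewrite ![_ == a]eq_sym.
  have [cb db dc] : [/\ c != b, d != b & d != c].
    by rewrite ![_ == b]eq_sym [d == c]eq_sym.
  have u3 x y z : x != y -> x != z -> y != z -> uniq [:: x; y; z].
    by rewrite /= !inE negb_or => -> -> ->.
  (* The primed point on this line comes from [b] or [c]; [c] is excluded because [T] already joins
     [u a] to [p c]. The next line, through [u b] and [u d], is treated alike. *)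
  have [q1 [T1 [+ q1a q1d [T1D a1 d1 p1]]]] := line a d aB dB ad.
  rewrite BE !inE (negbTE q1a) (negbTE q1d) orbF /= => /orP[] /eqP q1E; subst q1;
    last by apply: (clash a b d c T T1); rewrite ?u3.
  have [q2 [T2 [+ q2b q2d [T2D b2 d2 p2]]]] := line b d bB dB bd.
  rewrite BE !inE (negbTE q2b) (negbTE q2d) orbF /= => /orP[] /eqP q2E; subst q2;
    last by apply: (clash b a d c T T2); rewrite ?u3.
  (* Now [T1] joins [u a] to [p b], and [T2] joins [u b] to [p a], so [p d] is all that remains for
     both lines through [u c]. *)
  have [q3 [T3 [+ q3a q3c [T3D a3 c3 p3]]]] := line a c aB cB ac.
  rewrite BE !inE (negbTE q3a) (negbTE q3c) /= => /orP[] /eqP q3E; subst q3;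
    first by apply: (clash a d c b T1 T3); rewrite ?u3.
  have [q4 [T4 [+ q4b q4c [T4D b4 c4 p4]]]] := line b c bB cB bc.
  rewrite BE !inE (negbTE q4b) (negbTE q4c) /= => /orP[] /eqP q4E; subst q4;
    first by apply: (clash b d c a T2 T4); rewrite ?u3.
  by apply: (clash c a b d T3 T4); rewrite ?u3.
move: (enum_uniq B) (mem_enum B) B4; rewrite cardE.
case: (enum B) => [|a [|b [|c [|d []]]]] //= uB BE _.
have aB : a \in B by rewrite -BE !inE eqxx.
have bB : b \in B by rewrite -BE !inE eqxx orbT.
have ab : a != b by move: uB; rewrite !inE !negb_or => /andP[/andP[]].
have [q [T [+ qa qb [TD aT bT qT]]]] := line a b aB bB ab.
rewrite -BE !inE (negbTE qa) (negbTE qb) /= => /orP[] /eqP qE; subst q.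
  by case: (core a b c d uB _ T) => // x; rewrite BE.
(* If the line through [u a] and [u b] carries [p d] instead of [p c], [core] applies with [c] and
   [d] exchanged. *)
have perm_cd : perm_eq [:: a; b; d; c] [:: a; b; c; d].
  by rewrite !perm_cons (perm_catC [:: d] [:: c]).
case: (core a b d c _ _ T) => //; first by rewrite (perm_uniq perm_cd).
by move=> x; rewrite (perm_mem perm_cd) BE.
Qed.

End UnprimedTriple.

Theorem theorem6p1 (V : finType) (v delta : nat) (Q : {set {set V}})
    (hQ : quadruple_system v Q)
    (hK : exists (D : {set {set kpoint V}}) (R : {set {set {set kpoint V}}}),
            is_KQ Q D R /\ colourable delta D) :
  colourable delta Q.
Proof.
have [D [R [[_ [t [r [tP DE]]]] [c cP]]]] := hK.
exists (fun q => c (unprimed q)) => B BQ [k Bk].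
have [[stsB _ _] inftyB] := tP B BQ.
have B4 : #|B| = 4 by have [_ sQ _] := hQ; have [] := sQ B BQ.
(* All points of [T] are unprimed copies of points of [B], so a single colour on [B] would make [T]
   monochromatic under [c]. *)
have [T TB /subsetP sT] := unprimed_triple _ _ _ stsB inftyB B4.
apply: (cP T); first by rewrite DE; apply/bigcupP; exists B.
by exists k => x /sT /imsetP[q qB ->]; apply: Bk.
Qed.
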